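(* Let $S$ be a $\Gamma$-semiring which has a left unity and a right unity, and let $R$ be its right operator semiring. For a fuzzy subset $\mu$ of $R$ let $\mu^{*}$ be the fuzzy subset of $S$ defined by $\mu^{*}(a)=\inf_{\alpha\in\Gamma}\mu([\alpha,a])$ for $a\in S$. Then: (1) if $\mu$ is a fuzzy left (respectively right) ideal of $R$, then $\mu^{*}$ is a fuzzy left (respectively right) ideal of $S$; (2) if $\mu$ is a fuzzy ideal of $R$, then $\mu^{*}$ is a fuzzy ideal of $S$.
   Context: $\Gamma$-semiring: $S$ and $\Gamma$ are (nonempty) additive commutative semigroups with a map $S\times\Gamma\times S\to S$, $(a,\alpha,b)\mapsto a\alpha b$, such that $a\alpha(b+c)=a\alpha b+a\alpha c$, $(a+b)\alpha c=a\alpha c+b\alpha c$, $a(\alpha+\beta)c=a\alpha c+a\beta c$, $a\alpha(b\beta c)=(a\alpha b)\beta c$ for all $a,b,c\in S$, $\alpha,\beta\in\Gamma$. No zero elements are assumed. Right operator semiring $R$: let $G$ be the free additive commutative semigroup generated by $\Gamma\times S$ (finite nonempty formal sums). Identify $\sum_i(\alpha_i,x_i)$ with $\sum_j(\beta_j,y_j)$ iff $\sum_i a\alpha_i x_i=\sum_j a\beta_j y_j$ for all $a\in S$; this is a congruence on $G$. The class of $\sum_i(\alpha_i,x_i)$ is written $\sum_i[\alpha_i,x_i]$. $R$ is the quotient, with the induced addition and the multiplication $(\sum_i[\alpha_i,x_i])(\sum_j[\beta_j,y_j])=\sum_{i,j}[\alpha_i,x_i\beta_j y_j]$; it is a semiring.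 Unities: a right unity of $S$ is a finite sum $\sum_j[\gamma_j,f_j]\in R$ with $\sum_j a\gamma_j f_j=a$ for all $a\in S$. A left unity of $S$ is given by finitely many $e_i\in S$, $\delta_i\in\Gamma$ with $\sum_i e_i\delta_i a=a$ for all $a\in S$. A fuzzy subset of a set $X$ is a function $X\to[0,1]$. A fuzzy subset $\mu$ of $S$ is a fuzzy left (respectively right) ideal of $S$ if for all $a,b\in S$, $\alpha\in\Gamma$: $\mu(a+b)\ge\min(\mu(a),\mu(b))$ and $\mu(a\alpha b)\ge\mu(b)$ (respectively $\mu(a\alpha b)\ge\mu(a)$). A fuzzy subset $\mu$ of $R$ is a fuzzy left (respectively right) ideal of $R$ if for all $p,q\in R$: $\mu(p+q)\ge\min(\mu(p),\mu(q))$ and $\mu(pq)\ge\mu(q)$ (respectively $\mu(pq)\ge\mu(p)$). A fuzzy ideal (of $S$ or of $R$) is a fuzzy subset that is both a fuzzy left ideal and a fuzzy right ideal. *)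

(* Defs.v *)
From HB Require Import structures.
From mathcomp Require Import all_boot all_order all_algebra generic_quotient.
From mathcomp Require Import finmap multiset.
From mathcomp Require Import boolp classical_sets reals interval_inference.

Set Implicit Arguments.
Unset Strict Implicit.
Unset Printing Implicit Defensive.
Import Order.TTheory GRing.Theory Num.Theory.
Local Open Scope mset_scope.
Local Open Scope ring_scope.
Local Open Scope quotient_scope.

(* [addSemigroupType] is MathComp's commutative additive semigroup, without
   zero; its choice structure is no restriction classically. *)
HB.mixin Record isGammaSemiring (Gamma : addSemigroupType) S of Algebra.AddSemigroup S := {
  gmul : S -> Gamma -> S -> S;
  carrier_inhabited : inhabited S;
  operators_inhabited : inhabited Gamma;
  gmulDr : forall a (x : Gamma) b c, gmul a x (b + c) = gmul a x b + gmul a x c;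
  gmulDl : forall a b (x : Gamma) c, gmul (a + b) x c = gmul a x c + gmul b x c;
  gmulDm : forall a (x y : Gamma) c, gmul a (x + y) c = gmul a x c + gmul a y c;
  gmulA : forall a (x : Gamma) b (y : Gamma) c,
    gmul a x (gmul b y c) = gmul (gmul a x b) y c
}.

#[short(type="gammaSemiringType")]
HB.structure Definition GammaSemiring (Gamma : addSemigroupType) :=
  {S of isGammaSemiring Gamma S & Algebra.AddSemigroup S}.

(* The free commutative semigroup on T: nonempty finite multisets. *)
Definition freeSg (T : choiceType) := {A : {mset T} | A != mset0}.
HB.instance Definition _ T := Choice.on (freeSg T).

Section FreeSemigroup.
Variable T : choiceType.
Implicit Types (g h : freeSg T) (s : seq T).

Lemma mset_neq0E (A : {mset T}) : (A != mset0) = ((A : seq T) != [::]).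
Proof.
congr (~~ _); apply/eqP/eqP => [->|E].
  by apply/eqP; rewrite -size_eq0 -all_pred0; apply/allP => x; rewrite in_mset0.
by rewrite -[A]seq_mset_id E; apply/msetP => x; rewrite mset_seqE mset0E.
Qed.

Lemma seq_mset_neq0 s : s != [::] -> seq_mset s != mset0.
Proof.
by move=> s0; rewrite mset_neq0E -size_eq0 (perm_size (perm_eq_seq_mset s)) size_eq0.
Qed.

Definition free_of_seq s (s0 : s != [::]) : freeSg T :=
  exist (fun A : {mset T} => A != mset0 : Prop) _ (seq_mset_neq0 s0).

Definition free_gen (x : T) : freeSg T := @free_of_seq [:: x] isT.

Lemma free_neq0 g : (val g : seq T) != [::].
Proof. by rewrite -mset_neq0E (valP g). Qed.

Lemma perm_msetD (A B : {mset T}) :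
  perm_eq (A `+` B)%mset ((A : seq T) ++ (B : seq T)).
Proof.
by apply/allP => x _ /=; rewrite count_cat !count_mem_mset msetE2.
Qed.

Lemma free_add_subproof g h : (val g `+` val h)%mset != mset0.
Proof.
rewrite mset_neq0E -size_eq0 (perm_size (perm_msetD _ _)) size_eq0.
by have := free_neq0 g; case: (val g : seq T).
Qed.

Definition free_add g h : freeSg T := exist (fun A : {mset T} => A != mset0 : Prop) _ (free_add_subproof g h).

Lemma free_addC : commutative free_add.
Proof. by move=> g h; apply/val_inj/msetP => x /=; rewrite !msetE2 addnC. Qed.

Lemma free_addA : associative free_add.
Proof. by move=> g h k; apply/val_inj/msetP => x /=; rewrite !msetE2 addnA. Qed.

HB.instance Definition _ := Algebra.isAddSemigroup.Build (freeSg T) free_addC free_addA.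

End FreeSemigroup.

Section FreeSum.
Variables (T : choiceType) (V : addSemigroupType).
Implicit Types (F : T -> V) (g : freeSg T).

(* As V has no zero, sums over possibly empty ranges live in [option V]. *)
Local Notation oplus := (oAC (@Algebra.addrA V) (@Algebra.addrC V)).
Definition osum I (s : seq I) (F : I -> V) : option V :=
  \big[oplus/None]_(p <- s) Some (F p).

Lemma osum_isSome I (s : seq I) (F : I -> V) : s <> [::] -> osum s F.
Proof.
by case: s => // x s _; rewrite /osum big_cons; case: (\big[_/_]_(_ <- _) _).
Qed.

Definition ovalue (o : option V) : o -> V :=
  if o is Some x then fun=> x else fun e => False_rect V (notF e).

Lemma ovalueK (o : option V) (e : o) : Some (ovalue e) = o.
Proof. by case: o e. Qed.

(* [fsum F g] is the sum of F p over p in g, counted with multiplicity. *)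
Definition fsum F g : V :=
  ovalue (@osum_isSome _ (val g : seq T) F (elimN eqP (free_neq0 g))).

Lemma fsumE F g : Some (fsum F g) = osum (val g : seq T) F.
Proof. exact: ovalueK. Qed.

Lemma fsum_gen F x : fsum F (free_gen x) = F x.
Proof.
apply: Some_inj; rewrite fsumE /osum (perm_big _ (perm_eq_seq_mset _)).
by rewrite big_seq1.
Qed.

Lemma fsumD F g h : fsum F (g + h) = fsum F g + fsum F h.
Proof.
apply: Some_inj; rewrite fsumE /osum (perm_big _ (perm_msetD _ _)) big_cat /=.
by rewrite -/(osum (val g : seq T) F) -/(osum (val h : seq T) F) -!fsumE oACE.
Qed.

Lemma fsum_split F F' g :
  fsum (fun p => F p + F' p) g = fsum F g + fsum F' g.
Proof.
apply: Some_inj; transitivity (oplus (Some (fsum F g)) (Some (fsum F' g))) => //.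
rewrite !fsumE /osum -big_split /=.
by apply: eq_bigr => p _; rewrite oACE.
Qed.

Lemma eq_fsum F F' g : F =1 F' -> fsum F g = fsum F' g.
Proof.
by move=> FF'; apply: Some_inj; rewrite !fsumE; apply: eq_bigr => p _; rewrite FF'.
Qed.

Lemma fsum_of_seq F (s : seq T) (s0 : s != [::]) :
  Some (fsum F (free_of_seq s0)) = osum s F.
Proof. by rewrite fsumE; apply: perm_big; exact: perm_eq_seq_mset. Qed.

End FreeSum.

Lemma fsum_morph (T : choiceType) (V W : addSemigroupType) (f : V -> W)
    (F : T -> V) (g : freeSg T) :
  {morph f : x y / x + y} -> f (fsum F g) = fsum (f \o F) g.
Proof.
move=> fD; apply: Some_inj; rewrite fsumE.
rewrite -[LHS]/(omap f (Some (fsum F g))) fsumE /osum.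
by apply: big_morph => // -[x|] [y|] //=; rewrite /oAC /= fD.
Qed.

Section RightOperatorSemiring.
Variables (Gamma : addSemigroupType) (S : gammaSemiringType Gamma).
Local Notation formal := (freeSg (Gamma * S)%type).
Implicit Types (a b : S) (x y : Gamma) (g h : formal).

(* The action a (sum_i (x_i, b_i)) = sum_i a x_i b_i of formal sums on S. *)
Definition formal_act a g : S := fsum (fun u => gmul a u.1 u.2) g.

Definition formal_eq g h : bool :=
  `[< forall a, formal_act a g = formal_act a h >].

Lemma formal_eq_refl : reflexive formal_eq.
Proof. by move=> g; apply/asboolP. Qed.

Lemma formal_eq_sym : symmetric formal_eq.
Proof. by move=> g h; apply/asboolP/asboolP => e a. Qed.

Lemma formal_eq_trans : transitive formal_eq.
Proof. by move=> h g k /asboolP e /asboolP f; apply/asboolP => a; rewrite e. Qed.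

Canonical formal_equiv :=
  EquivRel formal_eq formal_eq_refl formal_eq_sym formal_eq_trans.

Definition rightOp := {eq_quot formal_equiv}.
HB.instance Definition _ := Choice.on rightOp.
HB.instance Definition _ := EqQuotient.on rightOp.
Implicit Types p q r : rightOp.

(* The class [x, a] of a single pair; see [pi_fsumE] for general classes. *)
Definition rbracket x a : rightOp := \pi_rightOp (free_gen (x, a)).

(* The induced action of classes; independent of [repr] by [ract_pi]. *)
Definition ract a p : S := formal_act a (repr p).

Lemma ract_pi a g : ract a (\pi_rightOp g) = formal_act a g.
Proof.
rewrite /ract; have /eqquotP/asboolP E := reprK (\pi_rightOp g).
exact: E.
Qed.

Lemma rightOpP p q : (forall a, ract a p = ract a q) -> p = q.
Proof.
by move=> e; rewrite -[p]reprK -[q]reprK; apply/eqquotP/asboolP.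
Qed.

Definition radd p q : rightOp := \pi_rightOp (repr p + repr q).

(* Terms of (sum_i (x_i, a_i)) (sum_j (y_j, b_j)) = sum_ij (x_i, a_i y_j b_j);
   the product passes to classes by [pi_mulE]. *)
Definition formal_pairs g h : seq (Gamma * S) :=
  [seq (u.1, gmul u.2 v.1 v.2) | u <- val g : seq _, v <- val h : seq _].

Lemma formal_pairs_neq0 g h : formal_pairs g h != [::].
Proof.
rewrite -size_eq0 size_allpairs muln_eq0 !size_eq0 negb_or.
by rewrite !free_neq0.
Qed.

Definition formal_mul g h : formal := free_of_seq (formal_pairs_neq0 g h).

Definition rmul p q : rightOp := \pi_rightOp (formal_mul (repr p) (repr q)).

Lemma ractDl a b p : ract (a + b) p = ract a p + ract b p.
Proof.
by rewrite -fsum_split; apply: eq_fsum => z; rewrite gmulDl.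
Qed.

Lemma formal_act_mul a g h :
  formal_act a (formal_mul g h) = formal_act (formal_act a g) h.
Proof.
have -> : formal_act (formal_act a g) h =
    fsum (fun u => formal_act (gmul a u.1 u.2) h) g.
  apply: (@fsum_morph _ _ _ (formal_act ^~ h)) => b c.
  by rewrite -fsum_split; apply: eq_fsum => z; rewrite gmulDl.
apply: Some_inj; rewrite [LHS]fsum_of_seq fsumE /osum big_allpairs_dep /=.
apply: eq_bigr => u _; rewrite fsumE.
by apply: eq_bigr => v _; rewrite gmulA.
Qed.

Lemma ractDr a p q : ract a (radd p q) = ract a p + ract a q.
Proof. by rewrite ract_pi /formal_act fsumD. Qed.

Lemma ractM a p q : ract a (rmul p q) = ract (ract a p) q.
Proof. by rewrite ract_pi formal_act_mul. Qed.

Lemma raddC : commutative radd.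
Proof. by move=> p q; rewrite /radd Algebra.addrC. Qed.

Lemma raddA : associative radd.
Proof. by move=> p q r; apply: rightOpP => a; rewrite !ractDr Algebra.addrA. Qed.

HB.instance Definition _ := Algebra.isAddSemigroup.Build rightOp raddC raddA.

Lemma pi_addE g h : \pi_rightOp (g + h) = \pi_rightOp g + \pi_rightOp h.
Proof.
apply: rightOpP => a; rewrite -[_ + _ in RHS]/(radd _ _) ractDr !ract_pi.
exact: fsumD.
Qed.

Lemma pi_mulE g h :
  \pi_rightOp (formal_mul g h) = rmul (\pi_rightOp g) (\pi_rightOp h).
Proof. by apply: rightOpP => a; rewrite ractM !ract_pi formal_act_mul. Qed.

Lemma rmulA : associative rmul.
Proof. by move=> p q r; apply: rightOpP => a; rewrite !ractM. Qed.

Lemma rmulDl p q r : rmul (p + q) r = rmul p r + rmul q r.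
Proof. by apply: rightOpP => a; rewrite !(ractM, ractDr) ractDl. Qed.

Lemma rmulDr p q r : rmul p (q + r) = rmul p q + rmul p r.
Proof. by apply: rightOpP => a; rewrite !(ractM, ractDr). Qed.

Lemma pi_fsumE g : \pi_rightOp g = fsum (fun u => rbracket u.1 u.2) g.
Proof.
apply: rightOpP => a; rewrite ract_pi (@fsum_morph _ _ _ (ract a)).
  by apply: eq_fsum => -[x b] /=; rewrite ract_pi /formal_act fsum_gen.
exact: ractDr.
Qed.

Lemma rbracketM x a y b :
  rmul (rbracket x a) (rbracket y b) = rbracket x (gmul a y b).
Proof.
by apply: rightOpP => c; rewrite ractM !ract_pi /formal_act !fsum_gen /= gmulA.
Qed.

Definition is_right_unity (p : rightOp) := forall a, ract a p = a.

Definition is_left_unity (g : freeSg (S * Gamma)%type) :=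
  forall a, fsum (fun u => gmul u.1 u.2 a) g = a.

End RightOperatorSemiring.

Definition has_right_unity (Gamma : addSemigroupType)
  (S : gammaSemiringType Gamma) := exists p : rightOp S, is_right_unity p.

Definition has_left_unity (Gamma : addSemigroupType)
  (S : gammaSemiringType Gamma) :=
  exists g : freeSg (S * Gamma)%type, is_left_unity g.

Section FuzzyIdeals.
Variables (K : realType) (Gamma : addSemigroupType) (S : gammaSemiringType Gamma).

Definition fuzzy (X : Type) := X -> {i01 K}.

Definition fuzzy_left_ideal (mu : fuzzy S) :=
  (forall a b, Num.min (mu a)%:num (mu b)%:num <= (mu (a + b))%:num) /\
  (forall a (x : Gamma) b, (mu b)%:num <= (mu (gmul a x b))%:num).

Definition fuzzy_right_ideal (mu : fuzzy S) :=
  (forall a b, Num.min (mu a)%:num (mu b)%:num <= (mu (a + b))%:num) /\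
  (forall a (x : Gamma) b, (mu a)%:num <= (mu (gmul a x b))%:num).

Definition fuzzy_ideal (mu : fuzzy S) :=
  fuzzy_left_ideal mu /\ fuzzy_right_ideal mu.

Definition op_fuzzy_left_ideal (mu : fuzzy (rightOp S)) :=
  (forall p q, Num.min (mu p)%:num (mu q)%:num <= (mu (p + q))%:num) /\
  (forall p q, (mu q)%:num <= (mu (rmul p q))%:num).

Definition op_fuzzy_right_ideal (mu : fuzzy (rightOp S)) :=
  (forall p q, Num.min (mu p)%:num (mu q)%:num <= (mu (p + q))%:num) /\
  (forall p q, (mu p)%:num <= (mu (rmul p q))%:num).

Definition op_fuzzy_ideal (mu : fuzzy (rightOp S)) :=
  op_fuzzy_left_ideal mu /\ op_fuzzy_right_ideal mu.

Variable mu : fuzzy (rightOp S).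

Definition star_values (a : S) : set K :=
  [set (mu (rbracket x a))%:num | x in [set: Gamma]]%classic.

Lemma star_values_neq0 a : (star_values a !=set0)%classic.
Proof.
by have [x] := operators_inhabited (Gamma := Gamma) (s := S); eexists; exists x.
Qed.

Lemma star_ge0 a : 0 <= inf (star_values a).
Proof.
by apply: lb_le_inf; [exact: star_values_neq0 | move=> _ [x _ <-]].
Qed.

Lemma star_le1 a : inf (star_values a) <= 1.
Proof.
have [x] := operators_inhabited (Gamma := Gamma) (s := S).
apply: (@le_trans _ _ (mu (rbracket x a))%:num) => //.
by apply: ge_inf; [exists 0 => _ [y _ <-] | exists x].
Qed.

Definition fuzzy_star : fuzzy S := fun a => Itv01 (star_ge0 a) (star_le1 a).

End FuzzyIdeals.

(* Main.v *)
Require Import Defs.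
From mathcomp Require Import all_boot all_order all_algebra.
From mathcomp Require Import reals.
From mathcomp Require Import interval_inference.
Import Order.TTheory.

(** For fixed [x] the map [a] to [[x, a]] is additive ([rbracketD]), and [[y, a x b] = [y, a][x, b]]
    ([rbracketM]). Hence the ideal inequalities of [mu] in the operator semiring bound [mu] at
    [[y, a x b]] and [[x, a + b]] from below by values whose infima define [fuzzy_star mu]; taking
    the infimum over the outer operator finishes each case. *)

(** The two sides differ as formal sums; they agree as classes because a class is determined by its
    action on [S], where distributivity applies. *)
Lemma rbracketD (Gamma : addSemigroupType) (S : gammaSemiringType Gamma)
    (x : Gamma) (a b : S) :
  (rbracket x (a + b) = rbracket x a + rbracket x b)%R.
Proof.
apply: rightOpP => c; rewrite [RHS]ractDr !ract_pi /formal_act !fsum_gen /=.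
exact: gmulDr.
Qed.

Section FuzzyStar.
Local Open Scope ring_scope.
Variables (K : realType) (Gamma : addSemigroupType) (S : gammaSemiringType Gamma).
Variable mu : fuzzy K (rightOp S).

Lemma fuzzy_star_le (a : S) (x : Gamma) :
  (fuzzy_star mu a)%:num <= (mu (rbracket x a))%:num.
(* The infimum is a lower bound only of a set bounded below; 0 serves, as [mu] takes values in
   [0,1]. *)
Proof. by apply: ge_inf; [exists 0 => _ [y _ <-] | exists x]. Qed.

Lemma le_fuzzy_star (a : S) (t : K) :
  (forall x : Gamma, t <= (mu (rbracket x a))%:num) ->
  t <= (fuzzy_star mu a)%:num.
Proof.
(* Being the greatest lower bound requires a nonempty set, which holds since [Gamma] is
   inhabited. *)
move=> le_t; apply: lb_le_inf; first exact: star_values_neq0.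
by move=> _ [x _ <-].
Qed.

Lemma fuzzy_starD :
  (forall p q, Num.min (mu p)%:num (mu q)%:num <= (mu (p + q))%:num) ->
  forall a b : S, Num.min (fuzzy_star mu a)%:num (fuzzy_star mu b)%:num
                  <= (fuzzy_star mu (a + b))%:num.
Proof.
move=> muD a b; apply: le_fuzzy_star => x; rewrite rbracketD.
by apply: le_trans (muD _ _); rewrite le_min !ge_min !fuzzy_star_le orbT.
Qed.

Lemma fuzzy_star_left_ideal :
  op_fuzzy_left_ideal mu -> fuzzy_left_ideal (fuzzy_star mu).
Proof.
move=> [muD muM]; split=> [|a x b]; first exact: fuzzy_starD.
(* The right factor is [[x, b]] whatever [y] is, so the infimum for [b] is compared with its value
   at the given [x]. *)
apply: le_fuzzy_star => y; rewrite -rbracketM.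
exact: le_trans (fuzzy_star_le b x) (muM _ _).
Qed.

Lemma fuzzy_star_right_ideal :
  op_fuzzy_right_ideal mu -> fuzzy_right_ideal (fuzzy_star mu).
Proof.
move=> [muD muM]; split=> [|a x b]; first exact: fuzzy_starD.
(* Now the left factor [[y, a]] matters, so the infimum for [a] is compared with its value at the
   varying [y]. *)
apply: le_fuzzy_star => y; rewrite -rbracketM.
exact: le_trans (fuzzy_star_le a y) (muM _ _).
Qed.

End FuzzyStar.

Theorem proposition3p4 (K : realType) (Gamma : addSemigroupType)
    (S : gammaSemiringType Gamma)
    (hleft : has_left_unity S) (hright : has_right_unity S)
    (mu : fuzzy K (rightOp S)) :
  ((op_fuzzy_left_ideal mu -> fuzzy_left_ideal (fuzzy_star mu)) /\
   (op_fuzzy_right_ideal mu -> fuzzy_right_ideal (fuzzy_star mu))) /\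
  (op_fuzzy_ideal mu -> fuzzy_ideal (fuzzy_star mu)).
Proof.
split; first by split; [exact: fuzzy_star_left_ideal | exact: fuzzy_star_right_ideal].
move=> [muL muR].
by split; [exact: fuzzy_star_left_ideal | exact: fuzzy_star_right_ideal].
Qed.
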